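(* Let $\mathbf H=(\underline H,\overline H,\tau)$ be a weak braided bimonad on a Cauchy complete category $\mathbb A$ and suppose that the functor $K_\omega:\mathbb A\to\mathbb A^{\overline H}_{\underline H}(\omega)$ admits a right adjoint $\overline K:\mathbb A^{\overline H}_{\underline H}(\omega)\to\mathbb A$. Then $\underline H^{\bar\xi}=(H^{\bar\xi},m^{\bar\xi},e^{\bar\xi})$ is the monad generated by the adjunction $K_\omega\dashv\overline K$, and $\iota^{\bar\xi}$ is the corresponding morphism of monads $\underline H^{\bar\xi}\to\underline H$.
   Context: Conventions. $\cdot$ is vertical composition of natural transformations; juxtaposition is composition of functors and whiskering, and $\varphi\psi$ is the horizontal composite of $\varphi,\psi$. $1$ is the identity. Cauchy complete means every idempotent splits. $\mathbb A_{\underline H}$, $\mathbb A^{\overline H}$ are the Eilenberg–Moore categories of modules and comodules. Weak YB-pair. For $H:\mathbb A\to\mathbb A$, natural transformations $\tau,\tau':HH\to HH$ form a weak YB-pair if $\tau\tau'\tau=\tau$, $\tau'\tau\tau'=\tau'$, $\tau\cdot\tau'=\tau'\cdot\tau$; $H\tau\cdot\tau H\cdot H\tau=\tau H\cdot H\tau\cdot\tau H$ and the same for $\tau'$; and, with $\nabla:=\tau\cdot\tau'$, $\tau H\cdot H\nabla=H\nabla\cdot\tau H$, $H\tau\cdot\nabla H=\nabla H\cdot H\tau$, and both equations with $\tau'$ in place of $\tau$. Weak braided bimonad. Let $\underline H=(H,m,e)$ be a monad and $\overline H=(H,\delta,\varepsilon)$ a comonad on $\mathbb A$ with the same endofunctor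 $H$, and $\tau,\tau'$ a weak YB-pair, $\nabla=\tau\cdot\tau'$. $\mathbf H=(\underline H,\overline H,\tau)$ is a weak braided bimonad if (1) $m\cdot\nabla=m$, $\nabla\cdot\delta=\delta$; (2) $\nabla\cdot He=\tau\cdot eH$, $H\varepsilon\cdot\nabla=\varepsilon H\cdot\tau$, $\nabla\cdot eH=\tau\cdot He$, $\varepsilon H\cdot\nabla=H\varepsilon\cdot\tau$; (3) $\delta H\cdot\tau=H\tau\cdot\tau H\cdot H\delta$, $\tau\cdot mH=Hm\cdot\tau H\cdot H\tau$; (4) $H\delta\cdot\tau=\tau H\cdot H\tau\cdot\delta H$, $\tau\cdot Hm=mH\cdot H\tau\cdot\tau H$; (5) $\delta\cdot m=mm\cdot H\tau H\cdot\delta\delta$; (6) $\varepsilon\varepsilon\cdot mm\cdot H\delta H=\varepsilon\cdot m\cdot mH=\varepsilon\varepsilon\cdot mm\cdot H\tau'H\cdot H\delta H$; (7) $HmH\cdot\delta\delta\cdot ee=\delta H\cdot\delta\cdot e=HmH\cdot H\tau'H\cdot\delta\delta\cdot ee$. Derived data. $\omega:=mH\cdot H\tau\cdot\delta H$, $\overline\omega:=Hm\cdot\tau H\cdot H\delta$ $(HH\to HH)$, $\bar\xi:=H\varepsilon\cdot\overline\omega\cdot He:H\to H$. $\bar\xi$ is idempotent; let $\bar\xi=\iota^{\bar\xi}\cdot q^{\bar\xi}$, $q^{\bar\xi}\cdot\iota^{\bar\xi}=1$ be a splitting through $H^{\bar\xi}$, and $m^{\bar\xi}:=q^{\bar\xi}\cdot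 m\cdot(\iota^{\bar\xi}\iota^{\bar\xi})$, $e^{\bar\xi}:=q^{\bar\xi}\cdot e$. Mixed bimodules. $\mathbb A^{\overline H}_{\underline H}(\omega)$ has as objects triples $(a,h,\theta)$ with $(a,h)\in\mathbb A_{\underline H}$, $(a,\theta)\in\mathbb A^{\overline H}$ and $\theta\cdot h=H(h)\cdot\omega_a\cdot H(\theta)$; morphisms are morphisms of $\mathbb A$ that are both $\underline H$-module and $\overline H$-comodule morphisms. $K_\omega(a)=(H(a),m_a,\delta_a)$. The monad generated by $K_\omega\dashv\overline K$ (unit $\overline\eta$, counit $\overline\varepsilon$) is $(\overline KK_\omega,\overline K\,\overline\varepsilon K_\omega,\overline\eta)$, and the corresponding monad morphism $\overline KK_\omega\to\underline H$ has components $\overline KK_\omega(a)\xrightarrow{e_{\overline KK_\omega(a)}}H\overline KK_\omega(a)\xrightarrow{\overline\varepsilon_{K_\omega(a)}}H(a)$. Being a right adjoint, $\overline K$ is only determined up to isomorphism; it is realised so that $\overline K(a,h,\theta)$ is the equaliser of $\theta$ and $H(h)\cdot\delta_a\cdot e_a:a\rightrightarrows H(a)$ (these equalisers exist precisely because $\overline K$ does), and the identification of monads is to be understood accordingly. *)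

(* Defs.v *)
From Stdlib Require Import ProofIrrelevance.

Set Implicit Arguments.
Unset Strict Implicit.
Unset Printing Implicit Defensive.

Declare Scope cat_scope.
Delimit Scope cat_scope with cat.
Local Open Scope cat_scope.

Record category := Category {
  ob :> Type;
  hom : ob -> ob -> Type;
  idm : forall a, hom a a;
  comp : forall a b c, hom b c -> hom a b -> hom a c;
  comp_idl : forall a b (f : hom a b), comp (idm b) f = f;
  comp_idr : forall a b (f : hom a b), comp f (idm a) = f;
  comp_assoc : forall a b c d (h : hom c d) (g : hom b c) (f : hom a b),
    comp (comp h g) f = comp h (comp g f)
}.
Arguments hom {_} _ _.
Arguments idm {_} _.
Arguments comp {_} {_ _ _} _ _.
Notation "g ∘ f" := (comp g f) (at level 40, left associativity) : cat_scope.

Record functor (C D : category) := Functor {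
  fob :> C -> D;
  fmap : forall a b, hom a b -> hom (fob a) (fob b);
  fmap_id : forall a, fmap (idm a) = idm (fob a);
  fmap_comp : forall a b c (g : hom b c) (f : hom a b),
    fmap (g ∘ f) = fmap g ∘ fmap f
}.
Arguments fmap {C D} F {a b} f : rename.

Record nat_trans (C D : category) (F G : functor C D) := NatTrans {
  component :> forall a, hom (F a) (G a);
  naturality : forall a b (f : hom a b),
    fmap G f ∘ component a = component b ∘ fmap F f
}.

Definition functor_id (C : category) : functor C C :=
  @Functor C C (fun a => a) (fun a b f => f)
    (fun a => eq_refl) (fun a b c g f => eq_refl).

Definition functor_comp (C D E : category) (F : functor D E) (G : functor C D) :
  functor C E.
Proof.
refine (@Functor C E (fun a => F (G a)) (fun a b f => fmap F (fmap G f)) _ _).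
- intros a; rewrite fmap_id; apply fmap_id.
- intros a b c g f; rewrite fmap_comp; apply fmap_comp.
Defined.

Definition hcomp (C D E : category) (F F' : functor D E) (G G' : functor C D)
    (phi : nat_trans F F') (psi : nat_trans G G') :
  nat_trans (functor_comp F G) (functor_comp F' G').
Proof.
refine (@NatTrans _ _ (functor_comp F G) (functor_comp F' G')
          (fun a => phi (G' a) ∘ fmap F (psi a)) _).
intros a b f; simpl.
rewrite <- comp_assoc, naturality, !comp_assoc, <- !fmap_comp, naturality.
reflexivity.
Defined.

Definition vcomp (C D : category) (F G K : functor C D)
    (psi : nat_trans G K) (phi : nat_trans F G) : nat_trans F K.
Proof.
refine (@NatTrans _ _ F K (fun a => psi a ∘ phi a) _).
intros a b f; rewrite <- comp_assoc, naturality, !comp_assoc, naturality.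
reflexivity.
Defined.

Definition is_iso (C : category) (a b : C) (f : hom a b) : Prop :=
  exists g : hom b a, g ∘ f = idm a /\ f ∘ g = idm b.

Definition is_equalizer (C : category) (a b c : C) (f g : hom b c)
    (i : hom a b) : Prop :=
  f ∘ i = g ∘ i /\
  forall (x : C) (k : hom x b), f ∘ k = g ∘ k ->
    exists! u : hom x a, i ∘ u = k.

Definition cauchy_complete (C : category) : Prop :=
  forall (a : C) (p : hom a a), p ∘ p = p ->
    exists (b : C) (i : hom b a) (q : hom a b), i ∘ q = p /\ q ∘ i = idm b.

Record adjunction (C D : category) (F : functor C D) (G : functor D C) :=
  Adjunction {
    adj_unit : nat_trans (functor_id C) (functor_comp G F);
    adj_counit : nat_trans (functor_comp F G) (functor_id D);
    adj_triangle_l : forall a : C,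
      adj_counit (F a) ∘ fmap F (adj_unit a) = idm (F a);
    adj_triangle_r : forall b : D,
      fmap G (adj_counit b) ∘ adj_unit (G b) = idm (G b)
  }.

Record monad_data (C : category) := MonadData {
  md_functor :> functor C C;
  md_mult : nat_trans (functor_comp md_functor md_functor) md_functor;
  md_unit : nat_trans (functor_id C) md_functor
}.
Arguments md_mult {C} _.
Arguments md_unit {C} _.

Record is_monad (C : category) (T : monad_data C) : Prop := IsMonad {
  monad_assoc : forall a,
    md_mult T a ∘ fmap T (md_mult T a) = md_mult T a ∘ md_mult T (T a);
  monad_unit_l : forall a, md_mult T a ∘ md_unit T (T a) = idm (T a);
  monad_unit_r : forall a, md_mult T a ∘ fmap T (md_unit T a) = idm (T a)
}.

Record is_monad_morphism (C : category) (S T : monad_data C)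
    (alpha : nat_trans S T) : Prop := IsMonadMorphism {
  monad_morphism_unit : forall a, alpha a ∘ md_unit S a = md_unit T a;
  monad_morphism_mult : forall a,
    alpha a ∘ md_mult S a = md_mult T a ∘ hcomp alpha alpha a
}.

Record is_comonad (C : category) (H : functor C C)
    (delta : nat_trans H (functor_comp H H))
    (eps : nat_trans H (functor_id C)) : Prop := IsComonad {
  comonad_coassoc : forall a,
    fmap H (delta a) ∘ delta a = delta (H a) ∘ delta a;
  comonad_counit_l : forall a, eps (H a) ∘ delta a = idm (H a);
  comonad_counit_r : forall a, fmap H (eps a) ∘ delta a = idm (H a)
}.

Definition generated_monad (C D : category) (F : functor C D)
    (G : functor D C) (adj : adjunction F G) : monad_data C.
Proof.
refine (@MonadData C (functor_comp G F)
  (@NatTrans _ _ (functor_comp (functor_comp G F) (functor_comp G F))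
     (functor_comp G F) (fun a => fmap G (adj_counit adj (F a))) _)
  (adj_unit adj)).
intros a b f; simpl; rewrite <- !fmap_comp.
f_equal; exact (naturality (adj_counit adj) (fmap F f)).
Defined.

(* Equations between natural transformations are stated on components: for
   [t : HH -> HH], the component at [a] of [Ht] is [fmap H (t a)] and that of
   [tH] is [t (H a)]. *)

Record weak_YB_pair (A : category) (H : functor A A)
    (tau tau' : nat_trans (functor_comp H H) (functor_comp H H)) : Prop :=
  WeakYBPair {
    yb_reg : forall a, tau a ∘ tau' a ∘ tau a = tau a;
    yb_reg' : forall a, tau' a ∘ tau a ∘ tau' a = tau' a;
    yb_comm : forall a, tau a ∘ tau' a = tau' a ∘ tau a;
    yb_braid : forall a,
      fmap H (tau a) ∘ tau (H a) ∘ fmap H (tau a) =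
      tau (H a) ∘ fmap H (tau a) ∘ tau (H a);
    yb_braid' : forall a,
      fmap H (tau' a) ∘ tau' (H a) ∘ fmap H (tau' a) =
      tau' (H a) ∘ fmap H (tau' a) ∘ tau' (H a);
    yb_nabla_l : forall a,
      tau (H a) ∘ fmap H (vcomp tau tau' a) =
      fmap H (vcomp tau tau' a) ∘ tau (H a);
    yb_nabla_r : forall a,
      fmap H (tau a) ∘ vcomp tau tau' (H a) =
      vcomp tau tau' (H a) ∘ fmap H (tau a);
    yb_nabla_l' : forall a,
      tau' (H a) ∘ fmap H (vcomp tau tau' a) =
      fmap H (vcomp tau tau' a) ∘ tau' (H a);
    yb_nabla_r' : forall a,
      fmap H (tau' a) ∘ vcomp tau tau' (H a) =
      vcomp tau tau' (H a) ∘ fmap H (tau' a)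
  }.

Record is_weak_braided_bimonad (A : category) (H : functor A A)
    (m : nat_trans (functor_comp H H) H) (e : nat_trans (functor_id A) H)
    (delta : nat_trans H (functor_comp H H)) (eps : nat_trans H (functor_id A))
    (tau tau' : nat_trans (functor_comp H H) (functor_comp H H)) : Prop :=
  IsWeakBraidedBimonad {
    wbb_monad : is_monad (MonadData m e);
    wbb_comonad : is_comonad delta eps;
    wbb_YB : weak_YB_pair tau tau';
    wbb_m_nabla : forall a, m a ∘ vcomp tau tau' a = m a;
    wbb_nabla_delta : forall a, vcomp tau tau' a ∘ delta a = delta a;
    wbb_nabla_He : forall a,
      vcomp tau tau' a ∘ fmap H (e a) = tau a ∘ e (H a);
    wbb_Heps_nabla : forall a,
      fmap H (eps a) ∘ vcomp tau tau' a = eps (H a) ∘ tau a;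
    wbb_nabla_eH : forall a,
      vcomp tau tau' a ∘ e (H a) = tau a ∘ fmap H (e a);
    wbb_epsH_nabla : forall a,
      eps (H a) ∘ vcomp tau tau' a = fmap H (eps a) ∘ tau a;
    wbb_deltaH_tau : forall a,
      delta (H a) ∘ tau a = fmap H (tau a) ∘ tau (H a) ∘ fmap H (delta a);
    wbb_tau_mH : forall a,
      tau a ∘ m (H a) = fmap H (m a) ∘ tau (H a) ∘ fmap H (tau a);
    wbb_Hdelta_tau : forall a,
      fmap H (delta a) ∘ tau a = tau (H a) ∘ fmap H (tau a) ∘ delta (H a);
    wbb_tau_Hm : forall a,
      tau a ∘ fmap H (m a) = m (H a) ∘ fmap H (tau a) ∘ tau (H a);
    wbb_delta_m : forall a,
      delta a ∘ m a =
      hcomp m m a ∘ fmap H (tau (H a)) ∘ hcomp delta delta a;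
    wbb_eps_m : forall a,
      hcomp eps eps a ∘ hcomp m m a ∘ fmap H (delta (H a)) =
      eps a ∘ m a ∘ m (H a);
    wbb_eps_m' : forall a,
      eps a ∘ m a ∘ m (H a) =
      hcomp eps eps a ∘ hcomp m m a ∘ fmap H (tau' (H a))
        ∘ fmap H (delta (H a));
    wbb_delta_e : forall a,
      fmap H (m (H a)) ∘ hcomp delta delta a ∘ hcomp e e a =
      delta (H a) ∘ delta a ∘ e a;
    wbb_delta_e' : forall a,
      delta (H a) ∘ delta a ∘ e a =
      fmap H (m (H a)) ∘ fmap H (tau' (H a)) ∘ hcomp delta delta a
        ∘ hcomp e e a
  }.

Record weak_braided_bimonad (A : category) := WeakBraidedBimonad {
  wH : functor A A;
  wm : nat_trans (functor_comp wH wH) wH;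
  we : nat_trans (functor_id A) wH;
  wdelta : nat_trans wH (functor_comp wH wH);
  weps : nat_trans wH (functor_id A);
  wtau : nat_trans (functor_comp wH wH) (functor_comp wH wH);
  wtau' : nat_trans (functor_comp wH wH) (functor_comp wH wH);
  wbb_axioms : is_weak_braided_bimonad wm we wdelta weps wtau wtau'
}.
Arguments wH {A} _.
Arguments wm {A} _.
Arguments we {A} _.
Arguments wdelta {A} _.
Arguments weps {A} _.
Arguments wtau {A} _.
Arguments wtau' {A} _.

Section MixedBimodules.
Variables (A : category) (B : weak_braided_bimonad A).
Local Notation H := (wH B).
Local Notation m := (wm B).
Local Notation e := (we B).
Local Notation delta := (wdelta B).
Local Notation eps := (weps B).
Local Notation tau := (wtau B).

Definition underlying_monad : monad_data A := MonadData m e.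

Definition omega (a : A) : hom (H (H a)) (H (H a)) :=
  m (H a) ∘ fmap H (tau a) ∘ delta (H a).

Definition omega_bar (a : A) : hom (H (H a)) (H (H a)) :=
  fmap H (m a) ∘ tau (H a) ∘ fmap H (delta a).

Definition xi_bar (a : A) : hom (H a) (H a) :=
  fmap H (eps a) ∘ omega_bar a ∘ fmap H (e a).

Record xi_splitting := XiSplitting {
  xi_functor : functor A A;
  xi_iota : nat_trans xi_functor H;
  xi_q : nat_trans H xi_functor;
  xi_iota_q : forall a, xi_iota a ∘ xi_q a = xi_bar a;
  xi_q_iota : forall a, xi_q a ∘ xi_iota a = idm (xi_functor a)
}.

Definition xi_monad (S : xi_splitting) : monad_data A :=
  @MonadData A (xi_functor S)
    (vcomp (xi_q S) (vcomp m (hcomp (xi_iota S) (xi_iota S))))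
    (vcomp (xi_q S) e).

Record is_module (a : A) (h : hom (H a) a) : Prop := IsModule {
  module_assoc : h ∘ fmap H h = h ∘ m a;
  module_unit : h ∘ e a = idm a
}.

Record is_comodule (a : A) (theta : hom a (H a)) : Prop := IsComodule {
  comodule_coassoc : fmap H theta ∘ theta = delta a ∘ theta;
  comodule_counit : eps a ∘ theta = idm a
}.

Record mixed_bimodule := MixedBimodule {
  mb_ob : A;
  mb_act : hom (H mb_ob) mb_ob;
  mb_coact : hom mb_ob (H mb_ob);
  mb_module : is_module mb_act;
  mb_comodule : is_comodule mb_coact;
  mb_compat : mb_coact ∘ mb_act =
              fmap H mb_act ∘ omega mb_ob ∘ fmap H mb_coact
}.

Record mixed_morphism (M N : mixed_bimodule) := MixedMorphism {
  mm_hom : hom (mb_ob M) (mb_ob N);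
  mm_module : mm_hom ∘ mb_act M = mb_act N ∘ fmap H mm_hom;
  mm_comodule : mb_coact N ∘ mm_hom = fmap H mm_hom ∘ mb_coact M
}.

Lemma mixed_morphism_eq (M N : mixed_bimodule) (f g : mixed_morphism M N) :
  mm_hom f = mm_hom g -> f = g.
Proof.
destruct f as [f f1 f2], g as [g g1 g2]; simpl; intros ->.
f_equal; apply proof_irrelevance.
Qed.

Definition mixed_id (M : mixed_bimodule) : mixed_morphism M M.
Proof.
refine (@MixedMorphism M M (idm (mb_ob M)) _ _).
- now rewrite fmap_id, comp_idl, comp_idr.
- now rewrite fmap_id, comp_idl, comp_idr.
Defined.

Definition mixed_comp (M N P : mixed_bimodule) (g : mixed_morphism N P)
  (f : mixed_morphism M N) : mixed_morphism M P.
Proof.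
refine (@MixedMorphism M P (mm_hom g ∘ mm_hom f) _ _).
- rewrite comp_assoc, mm_module, <- comp_assoc, mm_module, comp_assoc.
  now rewrite fmap_comp.
- rewrite <- comp_assoc, mm_comodule, comp_assoc, mm_comodule, <- comp_assoc.
  now rewrite fmap_comp.
Defined.

Definition mixed_bimodules : category.
Proof.
refine (@Category mixed_bimodule mixed_morphism mixed_id mixed_comp _ _ _);
  intros; apply mixed_morphism_eq; simpl.
- apply comp_idl.
- apply comp_idr.
- apply comp_assoc.
Defined.

Lemma free_compat (a : A) :
  delta a ∘ m a = fmap H (m a) ∘ omega (H a) ∘ fmap H (delta a).
Proof.
rewrite (wbb_delta_m (wbb_axioms B)); unfold omega; simpl.
pose proof (naturality m (m a)) as E; simpl in E.
rewrite <- E, !comp_assoc.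
reflexivity.
Qed.

Definition K_omega_ob (a : A) : mixed_bimodule.
Proof.
refine (@MixedBimodule (H a) (m a) (delta a) _ _ (free_compat a)).
- split.
  + exact (monad_assoc (wbb_monad (wbb_axioms B)) a).
  + exact (monad_unit_l (wbb_monad (wbb_axioms B)) a).
- split.
  + exact (comonad_coassoc (wbb_comonad (wbb_axioms B)) a).
  + exact (comonad_counit_l (wbb_comonad (wbb_axioms B)) a).
Defined.

Definition K_omega_map (a b : A) (f : hom a b) :
  mixed_morphism (K_omega_ob a) (K_omega_ob b).
Proof.
refine (@MixedMorphism (K_omega_ob a) (K_omega_ob b) (fmap H f) _ _).
- exact (naturality m f).
- exact (eq_sym (naturality delta f)).
Defined.

Definition K_omega : functor A mixed_bimodules.
Proof.
refine (@Functor A mixed_bimodules K_omega_ob K_omega_map _ _);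
  intros; apply mixed_morphism_eq; simpl.
- apply fmap_id.
- apply fmap_comp.
Defined.

Section RightAdjoint.
Variables (Kbar : functor mixed_bimodules A) (adj : adjunction K_omega Kbar).

(* A right adjoint of [K_omega] is determined up to isomorphism; any choice
   realises [Kbar M] as the equaliser of [mb_coact M] and [coinv_map M], by
   means of the inclusion [Kbar_incl M]. *)
Definition Kbar_incl (M : mixed_bimodules) : hom (Kbar M) (mb_ob M) :=
  mm_hom (adj_counit adj M) ∘ e (Kbar M).

Definition coinv_map (M : mixed_bimodules) : hom (mb_ob M) (H (mb_ob M)) :=
  fmap H (mb_act M) ∘ delta (mb_ob M) ∘ e (mb_ob M).

Definition generated_monad_morphism :
  nat_trans (generated_monad adj) underlying_monad.
Proof.
refine (@NatTrans _ _ (functor_comp Kbar K_omega) H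
          (fun a => Kbar_incl (K_omega a)) _).
intros a b f; unfold Kbar_incl; simpl.
pose proof (naturality e (fmap Kbar (fmap K_omega f))) as E; simpl in E.
rewrite (comp_assoc (mm_hom (adj_counit adj (K_omega_ob b)))).
etransitivity; [| exact (f_equal (comp _) E)].
rewrite <- !comp_assoc; f_equal.
exact (f_equal (@mm_hom _ _)
         (naturality (adj_counit adj) (fmap K_omega f))).
Defined.

End RightAdjoint.
End MixedBimodules.

(* Main.v *)
(** By the triangle identities [Kbar_incl M] is an equaliser of the coaction and
   the coinvariance map of [M]: a comodule morphism out of the free bimodule
   [K_omega x] is [h ∘ H k] for an arbitrary coinvariant [k : x -> M].  So it
   suffices that [iota a] is an equaliser of the pair belonging to [K_omega a],
   i.e. that [k : x -> H a] is coinvariant iff [xi_bar ∘ k = k].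
   Write [d = delta ∘ e].  Since [tauH ∘ Hd = Htau' ∘ dH], one has
   [xi_bar = Heps ∘ Hm ∘ Htau' ∘ dH], and the two forms of axiom (7) give
   [delta ∘ xi_bar = Hm ∘ dH ∘ xi_bar] and [xi_barH ∘ d = d] respectively.
   Finally, a coinvariant [k] equals [Heps ∘ Hm ∘ dH ∘ k] by counitality, which
   by naturality and [xi_barH ∘ d = d] is fixed by [xi_bar].  The monad
   structures are then compared after composing with the monomorphisms into
   [H]. *)
Require Import Defs.

Local Open Scope cat_scope.

Set Implicit Arguments.
Unset Strict Implicit.
Unset Printing Implicit Defensive.

(** * Rewriting inside composites *)

Ltac assoc_right := simpl; rewrite ?fmap_comp, ?comp_assoc.

Ltac comp_chain t k :=
  lazymatch t with
  | ?g ∘ ?f => let k' := comp_chain f k in comp_chain g k'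
  | _ => constr:(t ∘ k)
  end.

(* Rewrites with [E : l = r] inside a right-nested composite, where [l] may be
   any segment of the chain.  The binders [z_] and [k_] would capture
   hypotheses of the same name occurring in [E]. *)
Ltac rewrite_segment E :=
  let E1 := fresh in
  let E2 := fresh in
  pose proof E as E1; simpl in E1; rewrite ?fmap_comp, ?comp_assoc in E1;
  lazymatch type of E1 with
  | @eq (@hom _ ?x _) ?l ?r =>
    assert (E2 : forall z_ (k_ : hom z_ x),
              ltac:(let l' := comp_chain l k_ in
                    let r' := comp_chain r k_ in exact (l' = r')))
      by (intros z_ k_; rewrite <- ?comp_assoc;
          apply (f_equal (fun f => f ∘ k_));
          rewrite ?comp_assoc; exact E1)
  end;
  first [rewrite E2 | rewrite E1]; clear E1 E2;
  assoc_right; rewrite ?comp_idl, ?comp_idr.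

Tactic Notation "rew" uconstr(E) := rewrite_segment E.
Tactic Notation "rew" "<-" uconstr(E) := rewrite_segment (eq_sym E).

(** * Equalisers, and monad structures compared along monomorphisms *)

Lemma fmap_eq (C D : category) (F : functor C D) (a b : C) (f g : hom a b) :
  f = g -> fmap F f = fmap F g.
Proof. now intros ->. Qed.

Lemma equalizer_mono (C : category) (a b c : C) (f g : hom b c) (i : hom a b) :
  is_equalizer f g i ->
  forall (x : C) (u v : hom x a), i ∘ u = i ∘ v -> u = v.
Proof.
intros [E U] x u v Euv.
destruct (U x (i ∘ v)) as [w [_ Uw]].
{ now rewrite <- !comp_assoc, E. }
now rewrite <- (Uw u Euv), <- (Uw v eq_refl).
Qed.

Lemma equalizer_iso (C : category) (a a' b c : C) (f g : hom b c)
    (i : hom a b) (i' : hom a' b) (k : hom a a') :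
  is_equalizer f g i -> is_equalizer f g i' -> i' ∘ k = i -> is_iso k.
Proof.
intros Ei Ei' Ek. destruct (proj2 Ei a' i' (proj1 Ei')) as [l [El _]].
exists l. split.
- apply (equalizer_mono Ei). now rewrite <- comp_assoc, El, Ek, comp_idr.
- apply (equalizer_mono Ei'). now rewrite <- comp_assoc, Ek, El, comp_idr.
Qed.

Lemma hcomp_factor (C : category) (F G K : functor C C) (g : nat_trans G K)
    (k : nat_trans F G) (i : nat_trans F K) (a : C) :
  (forall b, g b ∘ k b = i b) ->
  hcomp g g a ∘ hcomp k k a = hcomp i i a.
Proof.
intros E. simpl. rewrite <- !E. assoc_right.
rew (naturality k (g a)). reflexivity.
Qed.

(** After composing with [i], multiplicativity and naturality reduce each axiom of [S] to the same
    axiom of [T]. *)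
Lemma is_monad_of_mono (C : category) (S T : monad_data C)
    (i : nat_trans S T) :
  is_monad T -> is_monad_morphism i ->
  (forall a x (u v : hom x (S a)), i a ∘ u = i a ∘ v -> u = v) ->
  is_monad S.
Proof.
intros HT Hi mono. split; intros a; apply mono.
- rew (monad_morphism_mult Hi a).
  rew (fmap_eq S (monad_morphism_mult Hi a)).
  rew <- (naturality i (md_mult T a)).
  rew (monad_assoc HT a).
  rew (monad_morphism_mult Hi a).
  rew (naturality (md_mult S) (i a)).
  rew (monad_morphism_mult Hi (T a)).
  reflexivity.
- rew (monad_morphism_mult Hi a).
  rew (naturality (md_unit S) (i a)).
  rew (monad_morphism_unit Hi (T a)).
  rew (monad_unit_l HT a). reflexivity.
- rew (monad_morphism_mult Hi a).
  rew (fmap_eq S (monad_morphism_unit Hi a)).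
  rew <- (naturality i (md_unit T a)).
  rew (monad_unit_r HT a). reflexivity.
Qed.

Lemma monad_morphism_cancel (C : category) (R S T : monad_data C)
    (k : nat_trans R S) (g : nat_trans S T) (i : nat_trans R T) :
  is_monad_morphism g -> is_monad_morphism i ->
  (forall a, g a ∘ k a = i a) ->
  (forall a x (u v : hom x (S a)), g a ∘ u = g a ∘ v -> u = v) ->
  is_monad_morphism k.
Proof.
intros Hg Hi E mono. split; intros a; apply mono.
- rewrite <- comp_assoc, E, (monad_morphism_unit Hg).
  apply (monad_morphism_unit Hi).
- rewrite <- !comp_assoc, E, (monad_morphism_mult Hg), (monad_morphism_mult Hi).
  rewrite comp_assoc, hcomp_factor with (1 := E). reflexivity.
Qed.

(** * The idempotent [xi_bar] and coinvariants *)

Section Bimonad.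
Variables (A : category) (B : weak_braided_bimonad A).
Local Notation H := (wH B).
Local Notation m := (wm B).
Local Notation e := (we B).
Local Notation delta := (wdelta B).
Local Notation eps := (weps B).
Local Notation tau := (wtau B).
Local Notation tau' := (wtau' B).
Local Notation ax := (wbb_axioms B).
Local Notation YB := (wbb_YB ax).

(** Composing the identity for Hδ·τ with τ'H produces ∇H, which slides past Hτ and is absorbed by
    δH. *)
Lemma fmap_tau_delta (a : A) :
  fmap H (tau a) ∘ delta (H a) = tau' (H a) ∘ fmap H (delta a) ∘ tau a.
Proof.
assoc_right. symmetry.
rew (wbb_Hdelta_tau ax a).
rew <- (yb_comm YB (H a)).
rew <- (yb_nabla_r YB a).
rew (wbb_nabla_delta ax (H a)).
reflexivity.
Qed.

Lemma delta_nabla (a : A) :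
  delta (H a) ∘ tau a ∘ tau' a =
  fmap H (tau a) ∘ fmap H (tau' a) ∘ delta (H a).
Proof.
(* Both sides equal H∇·δH·∇: the composite δH·τ has Hτ as its last factor, which absorbs H∇, and
   Hτ·δH has τ as its first factor, which absorbs ∇. *)
transitivity (fmap H (tau a) ∘ fmap H (tau' a) ∘ delta (H a)
  ∘ tau a ∘ tau' a); assoc_right.
- rew (wbb_deltaH_tau ax a). rew (fmap_eq H (yb_reg YB a)). reflexivity.
- do 2 rew (fmap_eq H (yb_comm YB a)). do 2 rew (fmap_tau_delta a).
  rew (yb_comm YB a). rew (yb_reg YB a). reflexivity.
Qed.

Definition delta_e (a : A) : hom a (H (H a)) := delta a ∘ e a.

Lemma delta_e_natural (a b : A) (f : hom a b) :
  fmap H (fmap H f) ∘ delta_e a = delta_e b ∘ f.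
Proof.
unfold delta_e. assoc_right.
rew (naturality delta f). rew (naturality e f). reflexivity.
Qed.

(** Write δ as ∇·δ and slide H∇ past τH. Its factor Hτ turns τH·Hδ into δH·τ; then τ·He = ∇·eH, and
    this ∇ crosses δH by [delta_nabla] and is absorbed by the remaining Hτ'. *)
Lemma tau_fmap_delta_e (a : A) :
  tau (H a) ∘ fmap H (delta_e a) = fmap H (tau' a) ∘ delta_e (H a).
Proof.
unfold delta_e. assoc_right.
rew <- (fmap_eq H (wbb_nabla_delta ax a)).
rew (yb_nabla_l YB a).
rew (fmap_eq H (yb_comm YB a)).
rew <- (wbb_deltaH_tau ax a).
rew <- (wbb_nabla_eH ax a).
rew (delta_nabla a).
rew (fmap_eq H (yb_reg' YB a)).
reflexivity.
Qed.

Lemma xi_barE (a : A) :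
  xi_bar B a =
  fmap H (eps a) ∘ fmap H (m a) ∘ fmap H (tau' a) ∘ delta_e (H a).
Proof.
unfold xi_bar, omega_bar. assoc_right.
rew <- (tau_fmap_delta_e a).
unfold delta_e. assoc_right. reflexivity.
Qed.

Lemma delta_delta_e (a : A) :
  delta (H a) ∘ delta_e a =
  fmap H (m (H a)) ∘ delta_e (H (H a)) ∘ delta_e a.
Proof.
unfold delta_e. assoc_right.
rew <- (wbb_delta_e ax a). rew (naturality e (delta a)). reflexivity.
Qed.

Lemma delta_delta_e' (a : A) :
  delta (H a) ∘ delta_e a =
  fmap H (m (H a)) ∘ fmap H (tau' (H a)) ∘ delta_e (H (H a)) ∘ delta_e a.
Proof.
unfold delta_e. assoc_right.
rew (wbb_delta_e' ax a). rew (naturality e (delta a)). reflexivity.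
Qed.

(** Naturality of δ exposes δH·d, to which [delta_delta_e] applies; naturality of d and m then
    reassembles [xi_bar] on the right. *)
Lemma delta_xi_bar (a : A) :
  delta a ∘ xi_bar B a = fmap H (m a) ∘ delta_e (H a) ∘ xi_bar B a.
Proof.
rewrite xi_barE. assoc_right.
rew <- (naturality delta (eps a)).
rew <- (naturality delta (m a)).
rew <- (naturality delta (tau' a)).
rew (delta_delta_e (H a)).
rew <- (delta_e_natural (fmap H (eps a))).
rew <- (delta_e_natural (fmap H (m a))).
rew <- (delta_e_natural (fmap H (tau' a))).
rew <- (fmap_eq H (naturality m (eps a))).
rew <- (fmap_eq H (naturality m (m a))).
rew <- (fmap_eq H (naturality m (tau' a))).
reflexivity.
Qed.

(** The unit axiom containing [tau'] rebuilds δH·d, and Hε cancels δH. *)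
Lemma xi_bar_delta_e (a : A) : xi_bar B (H a) ∘ delta_e a = delta_e a.
Proof.
rewrite xi_barE. assoc_right.
rew <- (delta_delta_e' a).
rew (comonad_counit_r (wbb_comonad ax) (H a)). reflexivity.
Qed.

Lemma xi_bar_natural (a b : A) (f : hom a b) :
  fmap H f ∘ xi_bar B a = xi_bar B b ∘ fmap H f.
Proof.
rewrite !xi_barE. assoc_right.
rew (fmap_eq H (naturality eps f)).
rew (fmap_eq H (naturality m f)).
rew (fmap_eq H (naturality tau' f)).
rew (delta_e_natural (fmap H f)). reflexivity.
Qed.

Lemma coinvariant_xi_bar (x a : A) (k : hom x (H a)) :
  delta a ∘ k = fmap H (m a) ∘ delta_e (H a) ∘ k -> xi_bar B a ∘ k = k.
Proof.
intros E.
assert (E' : k = fmap H (eps a) ∘ fmap H (m a) ∘ delta_e (H a) ∘ k).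
{ assoc_right. rewrite comp_assoc in E. rew <- E.
  rew (comonad_counit_r (wbb_comonad ax) a). reflexivity. }
rewrite E'; assoc_right.
rew <- (xi_bar_natural (eps a)).
rew <- (xi_bar_natural (m a)).
rew (xi_bar_delta_e (H a)). reflexivity.
Qed.

(** * Bimodule morphisms out of free bimodules *)

Lemma omega_natural (a b : A) (f : hom a b) :
  fmap H (fmap H f) ∘ omega B a = omega B b ∘ fmap H (fmap H f).
Proof.
unfold omega. assoc_right.
rew (naturality m (fmap H f)).
rew (fmap_eq H (naturality tau f)).
rew (naturality delta (fmap H f)). reflexivity.
Qed.

(** Compatibility of [M] brings the coaction next to k, where coinvariance replaces it.
    Associativity of the action then exposes Hm·ωH·Hδ, which is δ·m by [free_compat], and m cancels
    against He. *)
Lemma free_extension_comodule (M : mixed_bimodule B) (x : A)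
    (k : hom x (mb_ob M)) :
  mb_coact M ∘ k = coinv_map M ∘ k ->
  mb_coact M ∘ (mb_act M ∘ fmap H k) =
  fmap H (mb_act M ∘ fmap H k) ∘ delta x.
Proof.
unfold coinv_map. intros E. assoc_right.
rew (mb_compat M). rew (fmap_eq H E).
rew <- (omega_natural (mb_act M)).
rew (fmap_eq H (module_assoc (mb_module M))).
rew <- (free_compat B (mb_ob M)).
rew (monad_unit_r (wbb_monad ax) (mb_ob M)).
rew (naturality delta k). reflexivity.
Qed.

Definition free_extension (M : mixed_bimodules B) (x : A)
    (k : hom x (mb_ob M)) (E : mb_coact M ∘ k = coinv_map M ∘ k) :
  hom (K_omega B x) M.
Proof.
refine (@MixedMorphism A B (K_omega B x) M (mb_act M ∘ fmap H k) _ _).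
- assoc_right. rew (naturality m k).
  rew (module_assoc (mb_module M)). reflexivity.
- exact (free_extension_comodule E).
Defined.

(** * The right adjoint as an equaliser *)

Section RightAdjoint.
Variables (Kbar : functor (mixed_bimodules B) A).
Variables (adj : adjunction (K_omega B) Kbar).

Local Notation counit M := (mm_hom (adj_counit adj M)).
Local Notation T := (generated_monad adj).
Local Notation gamma := (generated_monad_morphism adj).

Lemma counit_natural (M N : mixed_bimodules B) (f : hom M N) :
  mm_hom f ∘ counit M = counit N ∘ fmap H (fmap Kbar f).
Proof. exact (f_equal (@mm_hom _ _ _ _) (naturality (adj_counit adj) f)). Qed.

Lemma counit_unit (a : A) :
  counit (K_omega B a) ∘ fmap H (adj_unit adj a) = idm (H a).
Proof. exact (f_equal (@mm_hom _ _ _ _) (adj_triangle_l adj a)). Qed.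

(** The counit is a module morphism out of a free module, hence determined by its composite with
    [e]. *)
Lemma counit_Kbar_incl (M : mixed_bimodules B) :
  counit M = mb_act M ∘ fmap H (Kbar_incl adj M).
Proof.
unfold Kbar_incl. assoc_right.
rew <- (mm_module (adj_counit adj M)).
rew (monad_unit_r (wbb_monad ax) (Kbar M)). reflexivity.
Qed.

Lemma Kbar_incl_equalizes (M : mixed_bimodules B) :
  mb_coact M ∘ Kbar_incl adj M = coinv_map M ∘ Kbar_incl adj M.
Proof.
unfold coinv_map. assoc_right.
rew <- (naturality e (Kbar_incl adj M)).
rew <- (naturality delta (Kbar_incl adj M)).
rew <- (fmap_eq H (counit_Kbar_incl M)).
unfold Kbar_incl. assoc_right.
rew (mm_comodule (adj_counit adj M)). reflexivity.
Qed.

Lemma Kbar_incl_mono (M : mixed_bimodules B) (x : A) (u v : hom x (Kbar M)) :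
  Kbar_incl adj M ∘ u = Kbar_incl adj M ∘ v -> u = v.
Proof.
intros E.
(* Each w is the transpose of a bimodule morphism whose underlying map, by [counit_Kbar_incl],
   depends only on [Kbar_incl adj M ∘ w]. *)
assert (R : forall w : hom x (Kbar M),
  w = fmap Kbar (comp (c := M) (adj_counit adj M) (fmap (K_omega B) w))
        ∘ adj_unit adj x).
{ intros w. rewrite fmap_comp. assoc_right. rew (naturality (adj_unit adj) w).
  rew (adj_triangle_r adj M). reflexivity. }
rewrite (R u), (R v). do 2 f_equal.
apply mixed_morphism_eq. simpl.
do 2 rew (counit_Kbar_incl M). rew (fmap_eq H E). reflexivity.
Qed.

Lemma Kbar_incl_natural (M N : mixed_bimodules B) (f : hom M N) :
  Kbar_incl adj N ∘ fmap Kbar f = mm_hom f ∘ Kbar_incl adj M.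
Proof.
unfold Kbar_incl. assoc_right.
rew <- (naturality e (fmap Kbar f)).
rew <- (counit_natural f). reflexivity.
Qed.

Lemma Kbar_incl_unit (a : A) :
  Kbar_incl adj (K_omega B a) ∘ adj_unit adj a = e a.
Proof.
unfold Kbar_incl. assoc_right.
rew <- (naturality e (adj_unit adj a)).
rew (counit_unit a). reflexivity.
Qed.

Definition Kbar_lift (M : mixed_bimodules B) (x : A) (k : hom x (mb_ob M))
    (E : mb_coact M ∘ k = coinv_map M ∘ k) : hom x (Kbar M) :=
  fmap Kbar (free_extension E) ∘ adj_unit adj x.

Lemma Kbar_incl_lift (M : mixed_bimodules B) (x : A) (k : hom x (mb_ob M))
    (E : mb_coact M ∘ k = coinv_map M ∘ k) :
  Kbar_incl adj M ∘ Kbar_lift E = k.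
Proof.
unfold Kbar_lift. rewrite <- comp_assoc, Kbar_incl_natural, comp_assoc.
etransitivity; [apply (f_equal (comp _) (Kbar_incl_unit x))|].
assoc_right.
rew (naturality e k). rew (module_unit (mb_module M)). reflexivity.
Qed.

Lemma Kbar_incl_equalizer (M : mixed_bimodules B) :
  is_equalizer (mb_coact M) (coinv_map M) (Kbar_incl adj M).
Proof.
split; [apply Kbar_incl_equalizes|]. intros x k E.
exists (Kbar_lift E). split.
- apply Kbar_incl_lift.
- intros u Eu. apply (Kbar_incl_mono (M := M)).
  now rewrite Eu, Kbar_incl_lift.
Qed.

(** Compatibility with multiplication comes from naturality of [Kbar_incl], used at the counit and
    again at the image under [K_omega] of the inclusion itself. *)
Lemma Kbar_incl_monad_morphism :
  is_monad_morphism (T := underlying_monad B) (generated_monad_morphism adj).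
Proof.
split; intros a.
- exact (Kbar_incl_unit a).
- etransitivity; [exact (Kbar_incl_natural (adj_counit adj (K_omega B a)))|].
  rewrite (counit_Kbar_incl (K_omega B a)), comp_assoc.
  symmetry; apply f_equal.
  exact (Kbar_incl_natural (fmap (K_omega B) (Kbar_incl adj (K_omega B a)))).
Qed.

Lemma coinv_map_K_omega (a : A) :
  coinv_map (K_omega B a) = fmap H (m a) ∘ delta_e (H a).
Proof. unfold coinv_map, delta_e. simpl. apply comp_assoc. Qed.

(** * Comparison of the split monad with the generated monad *)

Variable S : xi_splitting B.
Local Notation q := (xi_q S).
Local Notation iota := (xi_iota S).

Lemma xi_iota_mono (a x : A) (u v : hom x (xi_functor S a)) :
  iota a ∘ u = iota a ∘ v -> u = v.
Proof.
intros E. apply (f_equal (comp (q a))) in E.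
rewrite <- !comp_assoc, xi_q_iota, !comp_idl in E. exact E.
Qed.

Lemma xi_iota_equalizer (a : A) :
  is_equalizer (mb_coact (K_omega B a)) (coinv_map (K_omega B a)) (iota a).
Proof.
rewrite coinv_map_K_omega. split.
- assert (R : iota a = xi_bar B a ∘ iota a)
    by now rewrite <- (xi_iota_q S), comp_assoc, xi_q_iota, comp_idr.
  rewrite R, <- !comp_assoc. apply (f_equal (fun f => f ∘ iota a)).
  apply delta_xi_bar.
- intros x k E. exists (q a ∘ k). split.
  + rewrite <- comp_assoc, xi_iota_q. exact (coinvariant_xi_bar E).
  + intros u <-. rewrite <- comp_assoc, xi_q_iota. apply comp_idl.
Qed.

Definition xi_comparison_component (a : A) :
  hom (xi_functor S a) (Kbar (K_omega B a)) :=
  Kbar_lift (M := K_omega B a) (proj1 (xi_iota_equalizer a)).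

Lemma xi_comparison_natural (a b : A) (f : hom a b) :
  fmap T f ∘ xi_comparison_component a =
  xi_comparison_component b ∘ fmap (xi_functor S) f.
Proof.
apply (Kbar_incl_mono (M := K_omega B b)).
rewrite <- !comp_assoc.
etransitivity.
- apply (f_equal (fun h => h ∘ xi_comparison_component a)).
  exact (Kbar_incl_natural (fmap (K_omega B) f)).
- unfold xi_comparison_component. rewrite comp_assoc, !Kbar_incl_lift.
  exact (naturality iota f).
Qed.

Definition xi_comparison : nat_trans (xi_monad S) T :=
  @NatTrans _ _ (xi_monad S) T xi_comparison_component xi_comparison_natural.

Lemma Kbar_incl_xi_comparison (a : A) : gamma a ∘ xi_comparison a = iota a.
Proof. exact (Kbar_incl_lift (M := K_omega B a) _). Qed.

(** Removes the leading q from the unit and multiplication of [xi_monad S]: a map factoring through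
    [gamma] is coinvariant, hence fixed by [xi_bar]. *)
Lemma iota_q_of_factorization (a x : A) (k : hom x (H a)) (u : hom x (T a)) :
  gamma a ∘ u = k -> iota a ∘ (q a ∘ k) = k.
Proof.
intros <-. rewrite <- comp_assoc, xi_iota_q. apply coinvariant_xi_bar.
pose proof (Kbar_incl_equalizes (K_omega B a)) as E.
rewrite coinv_map_K_omega in E.
rewrite <- !comp_assoc. exact (f_equal (fun f => f ∘ u) E).
Qed.

Lemma xi_iota_monad_morphism :
  is_monad_morphism (S := xi_monad S) (T := underlying_monad B) iota.
Proof.
split; intros a.
- exact (iota_q_of_factorization (Kbar_incl_unit a)).
(* Since [gamma] is multiplicative and carries the comparison to iota, m·(iota iota) factors through
   it via the multiplication of [T]. *)
- apply (iota_q_of_factorization (k := m a ∘ hcomp iota iota a)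
           (u := md_mult T a ∘ hcomp xi_comparison xi_comparison a)).
  rewrite <- comp_assoc.
  rewrite (monad_morphism_mult Kbar_incl_monad_morphism a), comp_assoc.
  apply f_equal.
  exact (hcomp_factor (i := (iota : nat_trans (xi_monad S) (underlying_monad B)))
           a Kbar_incl_xi_comparison).
Qed.

End RightAdjoint.
End Bimonad.

Theorem proposition6p12 (A : category) (B : weak_braided_bimonad A)
  (hA : cauchy_complete A)
  (S : xi_splitting B)
  (Kbar : functor (mixed_bimodules B) A)
  (adj : adjunction (K_omega B) Kbar) :
  is_monad (xi_monad S) /\
  is_monad_morphism (S := xi_monad S) (T := underlying_monad B) (xi_iota S) /\
  (forall M : mixed_bimodules B,
     is_equalizer (mb_coact M) (coinv_map M) (Kbar_incl adj M)) /\
  exists kappa : nat_trans (xi_monad S) (generated_monad adj),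
    (forall a : A, is_iso (kappa a)) /\
    is_monad_morphism kappa /\
    (forall a : A, generated_monad_morphism adj a ∘ kappa a = xi_iota S a).
Proof.
pose proof (xi_iota_monad_morphism adj S) as Hiota.
split; [|split; [exact Hiota|split; [apply Kbar_incl_equalizer|]]].
- apply (is_monad_of_mono (T := underlying_monad B)
           (wbb_monad (wbb_axioms B)) Hiota).
  exact (@xi_iota_mono A B S).
- exists (xi_comparison adj S). split; [|split].
  (* The comparison is invertible because both inclusions into [H a] are equalisers of the same
     pair. *)
  + intros a. exact (equalizer_iso (xi_iota_equalizer S a)
      (Kbar_incl_equalizer adj (K_omega B a)) (Kbar_incl_xi_comparison adj S a)).
  + apply (monad_morphism_cancel (Kbar_incl_monad_morphism adj) Hiota
             (Kbar_incl_xi_comparison adj S)).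
    intros a x u v. exact (@Kbar_incl_mono A B Kbar adj (K_omega B a) x u v).
  + apply Kbar_incl_xi_comparison.
Qed.
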